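(* Let $\beta\in(1,2)$ be such that $\beta^m-\beta^{m-1}-\cdots-\beta-1=0$ for some integer $m\ge2$, and let $$c=\frac{(m-1)(2-\beta)}{2(m\beta+\beta-2m)}\quad(>0).$$ Then for any $p\in[\frac12-c,\frac12+c]$, Lebesgue almost every $x\in I_\beta$ has infinitely many $\beta$-expansions with frequency of zeros equal to $p$.
   Context: For $\beta\in(1,2)$, $I_\beta=[0,\frac{1}{\beta-1}]$, and a $\beta$-expansion of $x\in\mathbb{R}$ is a sequence $(\epsilon_i)_{i\ge1}\in\{0,1\}^{\mathbb{N}}$ (with $\mathbb{N}=\{1,2,3,\dots\}$) such that $x=\sum_{i=1}^\infty\epsilon_i\beta^{-i}$. The frequency of zeros of $(\epsilon_i)_{i\ge1}$ equals $p$ if the limit $\lim_{n\to\infty}\frac{\#\{1\le i\le n:\epsilon_i=0\}}{n}$ exists and equals $p$. *)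

(* Defs.v *)
From HB Require Import structures.
From mathcomp Require Import all_boot all_order all_algebra.
From mathcomp Require Import all_classical all_reals all_analysis.

Set Implicit Arguments.
Unset Strict Implicit.
Unset Printing Implicit Defensive.

Import Order.TTheory GRing.Theory Num.Theory.
Import numFieldNormedType.Exports.

Local Open Scope classical_set_scope.
Local Open Scope ring_scope.

(* A digit sequence (e_i)_(i >= 1) over {0, 1} is encoded as e : nat -> bool,
   where [e i] is the (i+1)-st digit and [true] stands for the digit 1. *)

Definition beta_interval (R : realType) (beta : R) : set R :=
  `[0, (beta - 1)^-1].

Definition is_beta_expansion (R : realType) (beta x : R) (e : nat -> bool) : Prop :=
  series (fun i => (e i)%:R * beta ^- i.+1) @ \oo --> x.

Definition zero_count (e : nat -> bool) (n : nat) : nat :=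
  #|[set i : 'I_n | ~~ e i]%SET|.

(* The term of index n = 0 is the junk value 0 / 0 = 0 and does not affect
   the limit. *)
Definition has_zero_frequency (R : realType) (e : nat -> bool) (p : R) : Prop :=
  (fun n => (zero_count e n)%:R / n%:R : R) @ \oo --> p.

(* Main.v *)
(* Since sum_(1 <= i <= m) beta^-i = 1, the greedy expansion of a Lebesgue random
   point of [0, 1) is a concatenation of independent blocks 1^j 0, 0 <= j < m, of
   probabilities beta^-(j+1). Replacing some of the words 1 0^m by 0 1^m, which
   have the same value, gives other expansions with m - 1 fewer zeros for each
   replacement. A strong law for bounded martingale differences (exponential
   moments and Borel-Cantelli) shows that almost surely (beta^m - 1) M + beta^m U
   = (beta - 1) n + o(n), where M and U are the numbers of words 1 0^m replaced
   and left alone among the first n blocks, for any rule of choice depending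
   on the past. Replacing in the right proportion realizes every frequency of
   zeros between that of the greedy expansion, 1/2 + c, and the one obtained by
   always replacing, which is at most 1/2 because beta >= 3/2. The symmetry
   x |-> 1/(beta-1) - x gives the frequencies below 1/2, and delaying the first
   replacement gives infinitely many expansions. *)

Require Import Defs.
From HB Require Import structures.
From mathcomp Require Import all_boot all_order all_algebra.
From mathcomp Require Import all_classical all_reals all_analysis.
From mathcomp Require Import ring lra zify.

Set Implicit Arguments.
Unset Strict Implicit.
Unset Printing Implicit Defensive.

Import Order.TTheory GRing.Theory Num.Theory.
Import numFieldNormedType.Exports.

Local Open Scope classical_set_scope.
Local Open Scope ring_scope.

(** * Strong law for bounded martingale differences along itineraries *)

Definition sublinear (R : realType) (f : nat -> R) : Prop :=
  forall eps : R, 0 < eps ->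
  exists n0, forall n, (n0 <= n)%N -> `|f n| <= eps * n%:R.

Section MartingaleLaw.
Variables (R : realType) (m : nat) (l q : nat -> R).
Hypothesis q_gt0 : forall j, 0 < q j.
Hypothesis q_sum : \sum_(j < m) q j = 1.

(** Expectation over n independent letters of law [q], by recursion on the first letter, so that no
    product probability space is needed. *)
Fixpoint expect (n : nat) (F : seq nat -> R) : R :=
  if n is n'.+1 then \sum_(j < m) q j * expect n' (fun w => F (val j :: w))
  else F [::].

Lemma expect_le n (F G : seq nat -> R) :
    (forall w, all (fun j => j < m)%N w -> F w <= G w) ->
  expect n F <= expect n G.
Proof.
elim: n F G => [|n IH] F G FG /=; first exact: FG.
apply: ler_sum => j _; rewrite ler_wpM2l ?(ltW (q_gt0 _))//.
by apply: IH => w mw; apply: FG; rewrite /= ltn_ord.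
Qed.

Lemma expectZ n c (F : seq nat -> R) :
  expect n (fun w => c * F w) = c * expect n F.
Proof.
elim: n F => [|n IH] F //=; rewrite mulr_sumr; apply: eq_bigr => j _.
by rewrite IH mulrCA.
Qed.

(* [mkseq b n] are the labels of the first n full affine branches
   z |-> l j + q j * z of [0, 1) onto the tiles containing the point [z 0]. *)
Definition itinerary (b : nat -> nat) (z : nat -> R) : Prop :=
  forall n, [/\ 0 <= z n < 1, (b n < m)%N & z n = l (b n) + q (b n) * z n.+1].

(** The points whose first n labels form a given word lie in an affine image of [0, 1), scaled by
    the product of the [q j]. The cover is the union over the words satisfying [P]. The factor 2
    comes from an interval symmetric about s, which serves both signs of r. *)
Lemma itinerary_cover n (P : seq nat -> bool) (s r : R) :
  exists A : set R, [/\ measurable A,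
    forall b z, itinerary b z -> P (mkseq b n) -> A (s + r * z 0) &
    (lebesgue_measure A <= (2 * `|r| * expect n (fun w => (P w)%:R))%:E)%E].
Proof.
elim: n P s r => [|n IH] P s r.
  case: (boolP (P [::])) => PN /=; last first.
    by exists set0; split => //; rewrite measure0 (negbTE PN) mulr0.
  exists `[s - `|r|, s + `|r|]%classic; split; first exact: measurable_itv.
    move=> b z /(_ 0%N) [/andP[z0 z1] _ _] _ /=; rewrite in_itv /=.
    have : `|r * z 0%N| <= `|r|.
      by rewrite normrM ler_piMr// ger0_norm// ltW.
    by rewrite ler_norml !lerD2l.
  rewrite lebesgue_measure_itv /=; case: ifP => _.
    by rewrite -EFinB lee_fin PN mulr1; lra.
  by rewrite lee_fin PN mulr1 mulr_ge0.
have /choice [A HA] : forall j : nat, exists A : set R, [/\ measurable A,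
    forall b z, itinerary b z -> P (j :: mkseq b n) ->
      A ((s + r * l j) + (r * q j) * z 0) &
    (lebesgue_measure A <= (2 * `|r * q j| * expect n (fun w => (P (j :: w))%:R))%:E)%E].
  by move=> j; exact: (IH (fun w => P (j :: w))).
exists (\big[setU/set0]_(j < m) A j); split.
- by apply: bigsetU_measurable => j _; case: (HA j).
- move=> b z bz; rewrite /mkseq /= => Pw.
  rewrite -bigcup_mkord; exists (b 0%N); first by case: (bz 0%N).
  have [_ + _] := HA (b 0%N).
  move=> /(_ (b \o S) (z \o S)) /= H.
  case: (bz 0%N) => _ _ ->.
  rewrite mulrDr addrA mulrA; apply: H; first by move=> k; exact: bz.
  by move: Pw; rewrite (iotaDl 1 0) -map_comp.
- apply: (@le_trans _ _ (\sum_(j < m) lebesgue_measure (A j))%E).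
    apply: (@content_subadditive _ _ _ lebesgue_measure) => //.
      by move=> k _; case: (HA k).
    by apply: bigsetU_measurable => j _; case: (HA j).
  rewrite /= mulr_sumr -sumEFin; apply: lee_sum => j _.
  have [_ _] := HA j; move=> /le_trans; apply.
  by rewrite normrM (gtr0_norm (q_gt0 j)) !mulrA.
Qed.

Variables (St : Type) (step : St -> nat -> St) (X : St -> nat -> R).
Variables (I : St -> Prop) (K : R).
Hypothesis I_step : forall s j, I s -> (j < m)%N -> I (step s j).
Hypothesis X_mean : forall s, I s -> \sum_(j < m) q j * X s j = 0.
Hypothesis X_bound : forall s j, I s -> (j < m)%N -> `|X s j| <= K.

Fixpoint path_sum (x : St -> nat -> R) (s : St) (w : seq nat) : R :=
  if w is j :: w' then x s j + path_sum x (step s j) w' else 0.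

Lemma path_sum_rcons x s w j :
  path_sum x s (rcons w j) = path_sum x s w + x (foldl step s w) j.
Proof.
elim: w s => [|i w IH] s /=; first by rewrite addr0 add0r.
by rewrite IH addrA.
Qed.

(** From 1 - u <= exp(-u) one gets exp u <= 1 / (1 - u), and (1 - u)(1 + u + 2u^2) = 1 + u^2 (1 -
    2u) >= 1. *)
Lemma expR_le_quadratic (u : R) : u <= 1 / 2 -> expR u <= 1 + u + 2 * u ^+ 2.
Proof.
move=> u_le; have h : 1 - u <= expR (- u) by apply: expR_ge1Dx.
have e_gt0 := expR_gt0 u.
have : (1 - u) * expR u <= 1.
  by apply: le_trans (ler_wpM2r (ltW e_gt0) h) _; rewrite -expRD addNr expR0.
have : 1 <= (1 - u) * (1 + u + 2 * u ^+ 2).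
  have := sqr_ge0 u; nra.
move=> h1 h2; have u1 : 0 < 1 - u by lra.
by rewrite -(ler_pM2l u1); lra.
Qed.

(** The linear term of the quadratic bound has mean zero in every state, so each letter costs a
    factor at most 1 + 2(tK)^2 <= exp(2(tK)^2). *)
Lemma expect_exp_path_sum n s t : I s -> 0 <= t -> t * K <= 1 / 2 ->
  expect n (fun w => expR (t * path_sum X s w)) <= expR (2 * (t * K) ^+ 2) ^+ n.
Proof.
move=> + t_ge0 tK; elim: n s => [|n IH] s Is /=.
  by rewrite mulr0 expR0 expr0.
set C := expR _.
have C_gt0 : 0 < C by exact: expR_gt0.
apply: (@le_trans _ _ (\sum_(j < m) q j * (expR (t * X s j) * C ^+ n))).
  apply: ler_sum => j _; rewrite ler_wpM2l ?(ltW (q_gt0 _))//.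
  apply: le_trans (ler_wpM2l (ltW (expR_gt0 _)) (IH _ (I_step Is (ltn_ord j)))).
  by rewrite -expectZ; apply: expect_le => w _; rewrite mulrDr expRD.
under eq_bigr do rewrite mulrA.
rewrite -mulr_suml exprS ler_wpM2r ?exprn_ge0 ?(ltW C_gt0)//.
apply: (@le_trans _ _ (1 + 2 * (t * K) ^+ 2)); last exact: expR_ge1Dx.
apply: (@le_trans _ _ (\sum_(j < m) (q j * (1 + 2 * (t * K) ^+ 2) + t * (q j * X s j)))).
  apply: ler_sum => j _.
  have /ler_normlP[Xl Xu] := X_bound Is (ltn_ord j).
  have tX : t * X s j <= t * K by rewrite ler_wpM2l.
  have tX' : - (t * X s j) <= t * K by rewrite -mulrN ler_wpM2l.
  apply: le_trans (ler_wpM2l (ltW (q_gt0 _)) (expR_le_quadratic (le_trans tX tK))) _.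
  rewrite [leRHS](_ : _ = q j * (1 + 2 * (t * K) ^+ 2 + t * X s j)); last by ring.
  rewrite ler_wpM2l ?(ltW (q_gt0 _))//; nra.
by rewrite big_split /= -mulr_suml -mulr_sumr q_sum X_mean// mulr0 addr0 mul1r.
Qed.

Lemma expect_tail n s eps : I s -> 1 <= K -> 0 < eps <= 1 ->
  expect n (fun w => (eps * n%:R <= path_sum X s w)%R%:R) <=
  expR (- (eps ^+ 2 / (8 * K ^+ 2))) ^+ n.
Proof.
(* This t minimizes the Chernoff exponent 2 t^2 K^2 - t eps. *)
move=> Is K1 /andP[e0 e1]; set t := eps / (4 * K ^+ 2).
have K0 : 0 < K by lra.
have K2 : 0 < K ^+ 2 by rewrite exprn_gt0.
have t0 : 0 <= t by rewrite divr_ge0 ?mulr_ge0// ltW.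
have tKE : t * K = eps / (4 * K) by rewrite /t; field; lra.
have tK : t * K <= 1 / 2.
  by rewrite tKE ler_pdivrMr ?mulr_gt0//; lra.
apply: (@le_trans _ _ (expect n (fun w => expR (- (t * eps * n%:R)) * expR (t * path_sum X s w)))).
  apply: expect_le => w _; rewrite -expRD.
  have [h|h] := lerP (eps * n%:R) (path_sum X s w); last exact: expR_ge0.
  rewrite -{1}(@expR0 R) ler_expR -mulrA addrC -mulrBr mulr_ge0//; lra.
rewrite expectZ.
apply: le_trans (ler_wpM2l (ltW (expR_gt0 _)) (expect_exp_path_sum n Is t0 tK)) _.
rewrite -!expRM_natr -expRD ler_expR tKE /t le_eqVlt; apply/orP; left; apply/eqP.
by field; lra.
Qed.

(** Borel-Cantelli: the measures are dominated by a convergent geometric series. *)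
Lemma geometric_lim_sup_negligible (A : nat -> set R) (C rho : R) :
    0 <= rho < 1 -> (forall n, measurable (A n)) ->
    (forall n, (lebesgue_measure (A n) <= (C * rho ^+ n)%:E)%E) ->
  (@lebesgue_measure R).-negligible (lim_sup_set A).
Proof.
move=> /andP[rho0 rho1] mA A_le.
have mlim : measurable (lim_sup_set A).
  apply: bigcapT_measurable => k; apply: bigcup_measurable => j _; exact: mA.
apply/negligibleP => //; apply: lim_sup_set_cvg0 => //.
apply: (@le_lt_trans _ _ (`|C| / (1 - rho))%:E); last exact: ltry.
apply: lime_le; first by apply: is_cvg_nneseries => n _ _; exact: measure_ge0.
apply: nearW => n.
apply: (@le_trans _ _ (\sum_(0 <= i < n) (`|C| * rho ^+ i)%:E)%E).
  apply: lee_sum => i _; apply: le_trans (A_le i) _.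
  by rewrite lee_fin ler_wpM2r ?exprn_ge0// ler_norm.
rewrite sumEFin lee_fin.
have -> : \sum_(0 <= i < n) `|C| * rho ^+ i = series (geometric `|C| rho) n by [].
rewrite geometric_seriesE ?lt_eqF// /= ler_pM2r ?invr_gt0 ?subr_gt0//.
by rewrite ler_piMr// gerBl exprn_ge0.
Qed.

Lemma large_deviation_negligible (sg : St) (eps s r : R) :
  I sg -> 1 <= K -> 0 < eps <= 1 ->
  (@lebesgue_measure R).-negligible [set x | exists b z,
    [/\ itinerary b z, x = s + r * z 0%N &
     forall n0, exists2 n, (n0 <= n)%N & eps * n%:R <= path_sum X sg (mkseq b n)]].
Proof.
move=> Isg K1 heps.
have /choice [A HA] : forall n : nat, exists A : set R, [/\ measurable A,
    forall b z, itinerary b z -> eps * n%:R <= path_sum X sg (mkseq b n) ->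
      A (s + r * z 0%N) &
    (lebesgue_measure A <=
      (2 * `|r| * expect n (fun w => (eps * n%:R <= path_sum X sg w)%R%:R))%:E)%E].
  move=> n.
  exact: (@itinerary_cover n (fun w => eps * n%:R <= path_sum X sg w)).
have A0 : (@lebesgue_measure R).-negligible (lim_sup_set A).
  apply: (@geometric_lim_sup_negligible A (2 * `|r|)
    (expR (- (eps ^+ 2 / (8 * K ^+ 2))))).
  - rewrite expR_ge0 -{2}(@expR0 R) ltr_expR oppr_lt0 divr_gt0//.
      by case/andP: heps => ? _; rewrite exprn_gt0.
    by rewrite mulr_gt0// exprn_gt0//; lra.
  - by move=> n; case: (HA n).
  - move=> n; have [_ _] := HA n; move=> /le_trans; apply.
    by rewrite lee_fin ler_wpM2l ?mulr_ge0// expect_tail.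
apply: negligibleS A0 => x [b [z [bz -> hb]]] k _; have [n kn hn] := hb k.
by exists n => //; have [_ + _] := HA n; apply.
Qed.

End MartingaleLaw.

Lemma path_sumN (R : realType) (St : Type) (step : St -> nat -> St)
    (X : St -> nat -> R) s w :
  path_sum step (fun s j => - X s j) s w = - path_sum step X s w.
Proof. by elim: w s => [|j w IH] s /=; rewrite ?oppr0// IH opprD. Qed.

(** Restricting eps to the values 1 / (k + 1) and splitting by sign leaves countably many one-sided
    events, each negligible by the large deviation bound. *)
Lemma not_sublinear (R : realType) (f : nat -> R) : ~ sublinear f ->
  exists k : nat,
    (forall n0, exists2 n, (n0 <= n)%N & k.+1%:R^-1 * n%:R <= f n) \/
    (forall n0, exists2 n, (n0 <= n)%N & k.+1%:R^-1 * n%:R <= - f n).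
Proof.
move=> /existsNP[eps /not_implyP[eps0 heps]].
have [k hk] : exists k : nat, k.+1%:R^-1 <= eps.
  have h : eps^-1 < (Num.bound eps^-1)%:R by apply: archi_boundP; rewrite invr_ge0 ltW.
  exists (Num.bound eps^-1).
  rewrite -[leRHS]invrK lef_pV2 ?posrE ?invr_gt0//.
  by rewrite (le_trans (ltW h))// ler_nat.
exists k; apply: contrapT => /not_orP[/existsNP[n1 h1] /existsNP[n2 h2]].
apply: heps; exists (maxn n1 n2) => n; rewrite geq_max => /andP[n1n n2n].
apply: (@le_trans _ _ (k.+1%:R^-1 * n%:R)); last by rewrite ler_wpM2r.
rewrite ler_norml; apply/andP; split; rewrite leNgt; apply/negP => hn.
  by apply: h2; exists n => //; rewrite ltW// ltrNr.
by apply: h1; exists n => //; exact: ltW.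
Qed.

Lemma martingale_strong_law (R : realType) (m : nat) (l q : nat -> R)
    (St : Type) (step : St -> nat -> St) (X : St -> nat -> R) (I : St -> Prop)
    (K : R) (sg : St) (s r : R) :
    (forall j, 0 < q j) -> \sum_(j < m) q j = 1 ->
    (forall s j, I s -> (j < m)%N -> I (step s j)) ->
    (forall s, I s -> \sum_(j < m) q j * X s j = 0) ->
    (forall s j, I s -> (j < m)%N -> `|X s j| <= K) -> I sg ->
  (@lebesgue_measure R).-negligible [set x | exists b z,
    [/\ itinerary m l q b z, x = s + r * z 0%N &
     ~ sublinear (fun n => path_sum step X sg (mkseq b n))]].
Proof.
move=> q0 q1 I_step X_mean X_bound Isg.
pose bad (Y : St -> nat -> R) (k : nat) := [set x : R | exists b z,
    [/\ itinerary m l q b z, x = s + r * z 0%N &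
     forall n0, exists2 n, (n0 <= n)%N &
       k.+1%:R^-1 * n%:R <= path_sum step Y sg (mkseq b n)]].
have bad0 (Y : St -> nat -> R) (k : nat) : (forall s, I s -> \sum_(j < m) q j * Y s j = 0) ->
    (forall s j, I s -> (j < m)%N -> `|Y s j| <= K) ->
    (@lebesgue_measure R).-negligible (bad Y k).
  move=> Y_mean Y_bound.
  (* The bound is enlarged to |K| + 1 because the tail estimate requires at least 1. *)
  apply: (@large_deviation_negligible R m l q q0 q1 St step Y I (`|K| + 1)) => //.
  - by move=> s' j Is jm; rewrite (le_trans (Y_bound _ _ Is jm))// ler_wpDr// ler_norm.
  - by rewrite lerDr.
  - by rewrite invr_gt0 ltr0n invf_le1 ?ler1n ?ltr0n.
have neg : (@lebesgue_measure R).-negligible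
    (\bigcup_k (bad X k `|` bad (fun s j => - X s j) k)).
  apply: negligible_bigcup => k; apply: negligibleU; apply: bad0 => //.
    by move=> s' /X_mean; under [in X in _ -> X]eq_bigr do rewrite mulrN;
      rewrite sumrN => ->; rewrite oppr0.
  by move=> s' j; rewrite normrN; exact: X_bound.
apply: negligibleS neg => x [b [z [bz xE /not_sublinear[k hk]]]].
exists k => //; case: hk => hk; [left|right]; exists b, z; split=> //.
by move=> n0; have [n ? ?] := hk n0; exists n => //; rewrite path_sumN.
Qed.

(** * Values of finite words in base beta *)

Section Words.
Variables (R : realType) (beta : R).
Hypothesis beta_gt1 : 1 < beta.

Definition word_value (w : seq bool) : R :=
  foldr (fun (b : bool) v => (b%:R + v) / beta) 0 w.

(** The value of 1^n, hence also the left end of the greedy tile of the block 1^n 0. *)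
Definition ones_value (n : nat) : R := \sum_(i < n) beta ^- i.+1.

Let beta_gt0 : 0 < beta. Proof. by rewrite (lt_trans ltr01). Qed.
Let beta_neq0 : beta != 0. Proof. by rewrite gt_eqF. Qed.
Let beta1_gt0 : 0 < beta - 1. Proof. by rewrite subr_gt0. Qed.

Lemma word_value_cat u v :
  word_value (u ++ v) = word_value u + beta ^- size u * word_value v.
Proof.
elim: u => [|b u IH] /=; first by rewrite expr0 invr1 mul1r add0r.
by rewrite IH exprS invfM; ring.
Qed.

Lemma word_value_nseq_false n : word_value (nseq n false) = 0.
Proof. by elim: n => [|n IH] //=; rewrite IH addr0 mul0r. Qed.

Lemma ones_valueS n : ones_value n.+1 = ones_value n + beta ^- n.+1.
Proof. by rewrite /ones_value big_ord_recr. Qed.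

Lemma ones_valueE n : ones_value n = (1 - beta ^- n) / (beta - 1).
Proof.
have b1 : beta - 1 != 0 by rewrite gt_eqF.
elim: n => [|n IH]; first by rewrite /ones_value big_ord0 expr0 invr1 subrr mul0r.
rewrite ones_valueS IH exprS invfM.
have : beta ^+ n != 0 by rewrite expf_neq0.
set c := beta ^+ n => c0; field.
by rewrite b1 c0 beta_neq0.
Qed.

Lemma word_value_nseq_true n : word_value (nseq n true) = ones_value n.
Proof.
elim: n => [|n IH] /=; first by rewrite /ones_value big_ord0.
have b1 : beta - 1 != 0 by rewrite gt_eqF.
have : beta ^+ n != 0 by rewrite expf_neq0.
rewrite IH !ones_valueE exprS invfM.
set c := beta ^+ n => c0; field.
by rewrite beta_neq0 c0 b1.
Qed.

Lemma word_value_ge0 w : 0 <= word_value w.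
Proof.
elim: w => [|b w IH] //=; rewrite divr_ge0 ?(ltW beta_gt0)//.
by rewrite addr_ge0.
Qed.

(** The bound is the fixed point of v |-> (1 + v) / beta. *)
Lemma word_value_le w : word_value w <= (beta - 1)^-1.
Proof.
elim: w => [|b w IH] /=; first by rewrite invr_ge0 ltW.
rewrite ler_pdivrMr//.
have -> : (beta - 1)^-1 * beta = 1 + (beta - 1)^-1 by field; rewrite gt_eqF.
by apply: lerD => //; case: b.
Qed.

Lemma word_value_mkseq (e : nat -> bool) n :
  word_value (mkseq e n) = series (fun i => (e i)%:R * beta ^- i.+1) n.
Proof.
elim: n => [|n IH]; first by rewrite /series /= big_geq.
have -> : mkseq e n.+1 = mkseq e n ++ [:: e n] by rewrite /mkseq -[n.+1]addn1 iotaD map_cat.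
rewrite word_value_cat IH size_mkseq /series /= big_nat_recr //= addr0 exprS invfM.
by congr (_ + _); ring.
Qed.

End Words.

(** * The rewriting automaton on greedy blocks *)

Section Rewriting.
Variable m : nat.
Hypothesis m_ge2 : (2 <= m)%N.

(* A greedy expansion is a concatenation of blocks 1^j 0 with j < m, read one at
   a time by [rewrite_step]. The digits [out] are final. If [run = Some k], the
   digits 1 0^k (read, or produced by a rewriting when k = 0) are withheld,
   because m - k further zeros would make 1 0^m replaceable by 0 1^m, which has
   the same value. [nmod] and [nkeep] count the words 1 0^m replaced and left
   alone; after one is left alone no rewriting takes place until the next 1. *)
Record state := State {
  out : seq bool; run : option nat; nmod : nat; nkeep : nat; clock : nat }.

Definition pending (r : option nat) : seq bool :=
  if r is Some k then true :: nseq k false else [::].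

Definition word (s : state) : seq bool := out s ++ pending (run s).

(** In a block 1^j 0 with j >= 1 only the last 1 can start a word 1 0^m, so the withheld digits and
    the other ones are released. After a replacement the last 1 of 0 1^m is withheld for the same
    reason. [dec] sees only the clock and the counts before the block. *)
Definition rewrite_step (dec : nat -> nat -> nat -> bool) (s : state) (j : nat) : state :=
  let: State o r M U i := s in
  if j is j'.+1 then State (o ++ pending r ++ nseq j' true) (Some 1%N) M U i.+1
  else if r is Some k then
    if k.+1 == m then
      if dec i M U then State (o ++ false :: nseq m.-1 true) (Some 0%N) M.+1 U i.+1
      else State (o ++ true :: nseq m false) None M U.+1 i.+1
    else State o (Some k.+1) M U i.+1
  else State (rcons o false) None M U i.+1.

Definition run_ok (s : state) : Prop := if run s is Some k then (k < m)%N else true.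

Section Step.
Variable dec : nat -> nat -> nat -> bool.
Notation step := (rewrite_step dec).

Lemma run_ok_step s j : run_ok s -> run_ok (step s j).
Proof.
case: s j => o [k|] M U i [|j] //=; rewrite /run_ok /= ?m_ge2//.
case: eqP => [_|km]; last by move=> /= kk; rewrite ltn_neqAle kk andbT; apply/eqP.
by case: dec => //= _; rewrite (ltn_trans _ m_ge2).
Qed.

Lemma clock_step s j : clock (step s j) = (clock s).+1.
Proof. by case: s j => o [k|] M U i [|j] //=; case: eqP => // _; case: dec. Qed.

Lemma size_word_step s j : size (word (step s j)) = (size (word s) + j.+1)%N.
Proof.
rewrite /word; case: s j => o [k|] M U i [|j] /=; rewrite ?size_cat /= ?size_cat ?size_rcons ?size_nseq //=.
- case: eqP => [km|_]; last by rewrite /= size_nseq; lia.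
  by case: dec; rewrite /= !size_cat /= size_nseq; lia.
- lia.
- lia.
- lia.
Qed.

Lemma size_word_le s : run_ok s -> (size (word s) <= size (out s) + m)%N.
Proof.
rewrite /word size_cat leq_add2l /run_ok; case: (run s) => [k|] //=.
by rewrite size_nseq.
Qed.

Lemma out_step s j : exists v, out (step s j) = out s ++ v.
Proof.
case: s j => o [k|] M U i [|j] /=.
- by case: eqP => _; [case: dec => /=; eexists|exists [::]; rewrite cats0].
- by eexists.
- by exists [:: false]; rewrite cats1.
- by eexists.
Qed.

(** Every block 1^j 0 brings exactly one zero, and replacing 1 0^m by 0 1^m removes m - 1 zeros. *)
Lemma zeros_step s j :
  (count negb (word (step s j)) + m.-1 * nmod (step s j) =
   (count negb (word s) + m.-1 * nmod s).+1)%N.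
Proof.
rewrite /word; case: s j => o [k|] M U i [|j] /=.
- case: eqP => [km|_] /=; last by rewrite !count_cat /= !count_nseq /=; lia.
  have -> : m.-1 = k by rewrite -km.
  by case: dec; rewrite /= !count_cat /= !count_nseq /=; lia.
- by rewrite !count_cat /= !(count_cat, count_nseq) /=; lia.
- by rewrite -cats1 !count_cat /=; lia.
- by rewrite !count_cat /= !count_nseq /=; lia.
Qed.

End Step.
End Rewriting.

(** * Greedy blocks and the potential for multinacci bases *)

Section Multinacci.
Variables (R : realType) (beta : R) (m : nat).
Hypothesis beta_gt1 : 1 < beta.
Hypothesis m_ge2 : (2 <= m)%N.
Hypothesis ones_m : ones_value beta m = 1.

Notation q := (fun j : nat => beta ^- j.+1).
Notation l := (ones_value beta).

Let beta_gt0 : 0 < beta. Proof. by rewrite (lt_trans ltr01). Qed.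
Let beta_neq0 : beta != 0. Proof. by rewrite gt_eqF. Qed.
Let beta1_gt0 : 0 < beta - 1. Proof. by rewrite subr_gt0. Qed.

Lemma beta_expm : beta ^- m = 2 - beta.
Proof.
have := congr1 ( *%R^~ (beta - 1)) ones_m.
rewrite /= ones_valueE// divfK ?gt_eqF// mul1r; lra.
Qed.

(** As l m = 1, the tiles [l j, l (j + 1)) with j < m, of length [q j], partition [0, 1). *)
Lemma block_exists (y : R) : 0 <= y < 1 ->
  exists jz : nat * R, [/\ (jz.1 < m)%N, 0 <= jz.2 < 1 & y = l jz.1 + q jz.1 * jz.2].
Proof.
move=> /andP[y0]; rewrite -{1}ones_m => ym.
have [j [jm lj yj]] : exists j, [/\ (j < m)%N, l j <= y & y < l j.+1].
  elim: m ym => [|n IH] yn; first by move: yn; rewrite /l big_ord0 ltNge y0.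
  have [h|h] := ltP y (l n); last by exists n; rewrite ltnSn.
  by have [j [? ? ?]] := IH h; exists j; split => //; rewrite ltnS ltnW.
have q0 : 0 < beta ^+ j.+1 by rewrite exprn_gt0.
exists (j, beta ^+ j.+1 * (y - l j)) => /=; split => //; last first.
  by rewrite mulKf ?gt_eqF// addrC subrK.
rewrite mulr_ge0 ?(ltW q0) ?subr_ge0//= -ltr_pdivlMl// mulr1 ltrBlDr addrC.
by rewrite -ones_valueS.
Qed.

Lemma itinerary_exists (y : R) : 0 <= y < 1 ->
  exists b z, itinerary m l q b z /\ z 0%N = y.
Proof.
move=> y01.
have /choice [f hf] : forall u : R, exists jz : nat * R, 0 <= u < 1 ->
    [/\ (jz.1 < m)%N, 0 <= jz.2 < 1 & u = l jz.1 + q jz.1 * jz.2].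
  move=> u; have [u01|nu] := pselect (0 <= u < 1).
    by have [jz ?] := block_exists u01; exists jz.
  (* A default outside [0, 1), never reached since the orbit stays inside. *)
  by exists (0%N, 0) => /nu.
pose z n := iter n (fun u => (f u).2) y.
have z01 n : 0 <= z n < 1.
  by elim: n => [|n IH] //=; case: (hf _ IH).
exists (fun n => (f (z n)).1), z; split => // n.
by have [? ? ?] := hf _ (z01 n); split.
Qed.

(* Up to the jumps at a completed 1 0^m, the expected increment of this
   potential over a block is the constant beta - 1 in every state. *)
Definition potential (s : state) : R := if run s is Some k then beta ^+ k else 0.

Definition drift (s : state) (j : nat) : R :=
  (if j == 0%N then beta * potential s else beta) - potential s - (beta - 1).

Section Step.
Variable dec : nat -> nat -> nat -> bool.
Notation step := (rewrite_step m dec).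

(** Completing 1 0^m would bring the potential to beta^m. A replacement resets it to 1 and leaving
    the word alone resets it to 0; the two coefficients are these losses. *)
Lemma potential_step s j :
  potential (step s j) + (beta ^+ m - 1) * (nmod (step s j))%:R
    + beta ^+ m * (nkeep (step s j))%:R =
  potential s + (beta ^+ m - 1) * (nmod s)%:R + beta ^+ m * (nkeep s)%:R
    + drift s j + (beta - 1).
Proof.
rewrite /drift /potential; case: s j => o [k|] M U i [|j] /=.
- case: eqP => [<-|_] /=; last by rewrite exprS; ring.
  by case: dec => /=; rewrite -?[M.+1]addn1 -?[U.+1]addn1 ?natrD ?exprS; ring.
- by ring.
- by ring.
- by ring.
Qed.

(** A replacement preserves the value because 1^m has value 1, so only the new block 1^j 0
    contributes. *)
Lemma word_value_step s j :
  word_value beta (word (step s j)) =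
  word_value beta (word s) + beta ^- size (word s) * l j.
Proof.
have l0 : l 0 = 0 by rewrite /ones_value big_ord0.
have one_zeros n : word_value beta (true :: nseq n false) = beta^-1.
  by rewrite /= word_value_nseq_false addr0 mul1r.
have zero_ones : word_value beta (false :: nseq m true) = beta^-1.
  by rewrite /= word_value_nseq_true// ones_m add0r mul1r.
have block o i : word_value beta (o ++ nseq i true ++ [:: true; false]) =
    word_value beta o + beta ^- size o * l i.+1.
  rewrite !word_value_cat word_value_nseq_true// size_nseq ones_valueS /= exprS invfM.
  by rewrite !addr0 !mul0r !addr0 mul1r [beta^-1 * _]mulrC.
have snoc_ones : nseq m.-1 true ++ [:: true] = nseq m true.
  have -> : [:: true] = nseq 1 true by [].
  by rewrite -nseqD addn1 prednK// ltnW.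
rewrite /word; case: s j => o r M U i [|j] /=; last first.
  by rewrite -block -!catA.
rewrite l0 mulr0 addr0; case: r => [k|] /=; last by rewrite !cats0 -cats1 word_value_cat /= !addr0 !mul0r mulr0 addr0.
case: eqP => [km|_] /=; last first.
  by rewrite !word_value_cat (one_zeros k) (one_zeros k.+1).
case: dec => /=.
  by rewrite -catA cat_cons snoc_ones !word_value_cat zero_ones one_zeros.
by rewrite cats0 !word_value_cat !one_zeros.
Qed.

End Step.
End Multinacci.

(** * The digit sequence produced from an itinerary *)

Lemma mkseqS (T : Type) (f : nat -> T) n : mkseq f n.+1 = rcons (mkseq f n) (f n).
Proof. by rewrite /mkseq -[n.+1]addn1 iotaD map_cat cats1. Qed.

Lemma zero_countE (e : nat -> bool) n : zero_count e n = count negb (mkseq e n).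
Proof.
rewrite /zero_count cardsE -sum1_card big_mkcond /=.
have -> : count negb (mkseq e n) = (\sum_(i < n) ~~ e i)%N.
  elim: n => [|n IH]; first by rewrite big_ord0.
  by rewrite mkseqS -cats1 count_cat big_ord_recr /= -IH addn0.
by apply: eq_bigr => i _; rewrite unfold_in; case: (e i).
Qed.

Section Trajectory.
Variable m : nat.
Hypothesis m_ge2 : (2 <= m)%N.
Variables (k0 : nat) (b : nat -> nat).

(** The leading ones serve the points of the whole interval, which an itinerary of [0, 1) alone does
    not reach. *)
Definition start : state := State (nseq k0 true) None 0 0 0.

Variable dec : nat -> nat -> nat -> bool.
Notation step := (rewrite_step m dec).

Definition traj (n : nat) : state := foldl step start (mkseq b n).

Lemma trajS n : traj n.+1 = step (traj n) (b n).
Proof. by rewrite /traj mkseqS foldl_rcons. Qed.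

Lemma traj_clock n : clock (traj n) = n.
Proof. by elim: n => [|n IH] //; rewrite trajS clock_step IH. Qed.

Lemma traj_run_ok n : run_ok m (traj n).
Proof. by elim: n => [|n IH] //; rewrite trajS; exact: run_ok_step. Qed.

Lemma traj_zeros n : (count negb (word (traj n)) + m.-1 * nmod (traj n) = n)%N.
Proof.
elim: n => [|n IH]; last by rewrite trajS zeros_step// IH.
by rewrite /traj /= /word /= cats0 count_nseq /=; lia.
Qed.

Lemma traj_size n : size (word (traj n)) = (k0 + \sum_(i < n) (b i).+1)%N.
Proof.
elim: n => [|n IH]; first by rewrite /traj /word /= cats0 size_nseq big_ord0 addn0.
by rewrite trajS size_word_step// IH big_ord_recr addnA.
Qed.

Lemma traj_size_ge n : (n <= size (word (traj n)))%N.
Proof. by elim: n => [|n IH] //; rewrite trajS size_word_step//; lia. Qed.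

Lemma traj_size_out n : (n <= size (out (traj n)) + m)%N.
Proof. exact: leq_trans (traj_size_ge n) (size_word_le (traj_run_ok n)). Qed.

Lemma traj_out_prefix n n' : (n <= n')%N -> exists v, out (traj n') = out (traj n) ++ v.
Proof.
move=> /subnK <-; elim: (n' - n)%N => [|d [v IH]]; first by exists [::]; rewrite cats0.
have [v' h] := out_step m dec (traj (d + n)) (b (d + n)%N).
by exists (v ++ v'); rewrite addSn trajS h IH catA.
Qed.

(* By [traj_size_out], digit i is final after i + m + 1 blocks. *)
Definition digit (i : nat) : bool := nth false (out (traj (i + m.+1))) i.

Lemma digitE n i : (i < size (out (traj n)))%N -> digit i = nth false (out (traj n)) i.
Proof.
move=> i_lt; rewrite /digit.
have i_lt' : (i < size (out (traj (i + m.+1))))%N by have := traj_size_out (i + m.+1); lia.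
have [h|/ltnW h] := leqP n (i + m.+1).
  by have [v ->] := traj_out_prefix h; rewrite nth_cat i_lt.
by have [v ->] := traj_out_prefix h; rewrite nth_cat i_lt'.
Qed.

Lemma mkseq_digit n N : (N <= size (out (traj n)))%N -> mkseq digit N = take N (out (traj n)).
Proof.
move=> hN; apply: (@eq_from_nth _ false); rewrite size_mkseq ?size_takel// => i iN.
by rewrite nth_mkseq// nth_take// (@digitE n)// (leq_trans iN).
Qed.

(** Each block has at most m digits, so the block ends leave no gap longer than m. *)
Lemma traj_time N : (forall n, (b n < m)%N) -> (k0 <= N)%N -> exists n, [/\ (n <= N)%N,
  (size (word (traj n)) <= N)%N & (N <= size (word (traj n)) + m)%N].
Proof.
move=> bm /subnK <-; elim: (N - k0)%N => [|d [n [nN sN Ns]]].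
  by exists 0%N; rewrite /traj /word /= cats0 size_nseq; split; lia.
have [h|h] := leqP (d.+1 + k0) (size (word (traj n)) + m); first by exists n; split; lia.
have {}bm := bm n.
have := size_word_step m_ge2 dec (traj n) (b n); rewrite -trajS => E.
by exists n.+1; rewrite E; split; have := traj_size_ge n.+1; lia.
Qed.

End Trajectory.

(** * The digits form an expansion of the given point *)

Section TrajectoryValue.
Variables (R : realType) (beta : R) (m : nat).
Hypothesis beta_gt1 : 1 < beta.
Hypothesis m_ge2 : (2 <= m)%N.
Hypothesis ones_m : ones_value beta m = 1.
Notation q := (fun j : nat => beta ^- j.+1).
Notation l := (ones_value beta).

Variables (k0 : nat) (b : nat -> nat) (z : nat -> R).
Hypothesis hb : itinerary m l q b z.

Variable dec : nat -> nat -> nat -> bool.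
Notation traj := (traj m k0 b dec).
Notation digit := (digit m k0 b dec).

(** Invariant: the word read so far plus the scaled tail [z n] always represents the same point,
    whatever is replaced. *)
Lemma traj_value n :
  l k0 + beta ^- k0 * z 0%N =
  word_value beta (word (traj n)) + beta ^- size (word (traj n)) * z n.
Proof.
elim: n => [|n ->].
  by rewrite /word /= cats0 size_nseq word_value_nseq_true.
rewrite trajS word_value_step// size_word_step//.
case: (hb n) => _ _ ->; rewrite mulrDr addrA; congr (_ + _).
by rewrite mulrA -invfM -exprD.
Qed.

Lemma digit_expansion : is_beta_expansion beta (l k0 + beta ^- k0 * z 0%N) digit.
Proof.
set x := _ + _.
have beta_gt0 : 0 < beta by rewrite (lt_trans ltr01).
(* After N + m blocks the first N digits are final. The error has two parts, both scaled by at most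
   beta^-N: the rest of the word, of value at most 1 / (beta - 1), and the tail, below 1. *)
have bnd N : 0 <= x - word_value beta (mkseq digit N) <=
    ((beta - 1)^-1 + 1) * beta^-1 ^+ N.
  have hN : (N <= size (out (traj (N + m))))%N by have := traj_size_out m_ge2 k0 b dec (N + m); lia.
  rewrite /x (traj_value (N + m)) (mkseq_digit m_ge2 hN).
  have wE : word (traj (N + m)) = take N (out (traj (N + m))) ++
      (drop N (out (traj (N + m))) ++ pending (run (traj (N + m)))).
    by rewrite catA cat_take_drop.
  set v := word_value beta (drop N (out (traj (N + m))) ++ pending (run (traj (N + m)))).
  have -> : word_value beta (word (traj (N + m))) =
      word_value beta (take N (out (traj (N + m)))) + beta ^- N * v.
    by rewrite wE word_value_cat size_takel.
  have v0 : 0 <= v by exact: word_value_ge0.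
  have vL : v <= (beta - 1)^-1 by exact: word_value_le.
  set t := word_value beta (take _ _); set u := _ * z _.
  have -> : t + beta ^- N * v + u - t = beta ^- N * v + u by ring.
  rewrite exprVn /u.
  have [/andP[z0 z1] _ _] := hb (N + m).
  have N0 : 0 < beta ^- N by rewrite invr_gt0 exprn_gt0.
  have NS : beta ^- size (word (traj (N + m))) <= beta ^- N.
    rewrite lef_pV2 ?posrE ?exprn_gt0// ler_eXn2l//.
    by have := traj_size_ge m_ge2 k0 b dec (N + m); lia.
  have S0 : 0 < beta ^- size (word (traj (N + m))) by rewrite invr_gt0 exprn_gt0.
  apply/andP; split; nra.
rewrite /is_beta_expansion; apply/cvgrPdist_le => eps eps0.
have b1 : `|beta^-1| < 1 by rewrite gtr0_norm ?invr_gt0// invf_lt1.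
have /cvgrPdist_le /(_ _ eps0) := @cvg_geometric R ((beta - 1)^-1 + 1) _ b1.
apply: filterS => N /=; rewrite sub0r normrN -word_value_mkseq => h.
have /andP[h0 h1] := bnd N; rewrite ger0_norm//.
exact: le_trans h1 (le_trans (ler_norm _) h).
Qed.

End TrajectoryValue.

(** * Calculus of o(n) sequences *)

Section Sublinear.
Variable R : realType.
Implicit Types f g : nat -> R.

(** Trading the threshold for an additive constant allows use at a block count n which is only known
    to be at most N. *)
Lemma sublinear_bound f : sublinear f ->
  forall eps, 0 < eps -> exists C, forall n, `|f n| <= eps * n%:R + C.
Proof.
move=> hf eps eps0; have [n0 hn0] := hf _ eps0.
exists (\sum_(i < n0) `|f i|) => n; have [h|h] := leqP n0 n.
  by apply: le_trans (hn0 _ h) _; rewrite lerDl sumr_ge0.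
rewrite (bigD1 (Ordinal h)) //= addrCA lerDl addr_ge0 ?sumr_ge0// mulr_ge0//.
exact: ltW.
Qed.

Lemma sublinear_affine f g (c d : R) : sublinear f -> sublinear g ->
  sublinear (fun n => c * f n + d * g n).
Proof.
move=> hf hg eps eps0.
have c0 : 0 < `|c| + `|d| + 1 by rewrite ltr_wpDl ?addr_ge0.
have [e e0 ->] : exists2 e, 0 < e & eps = e * (`|c| + `|d| + 1).
  by exists (eps / (`|c| + `|d| + 1)); rewrite ?divr_gt0// divfK// gt_eqF.
have [n1 h1] := hf _ e0; have [n2 h2] := hg _ e0.
exists (maxn n1 n2) => n; rewrite geq_max => /andP[/h1 {}h1 /h2 {}h2].
apply: le_trans (ler_normD _ _) _; rewrite !normrM.
apply: le_trans (lerD (ler_wpM2l (normr_ge0 _) h1) (ler_wpM2l (normr_ge0 _) h2)) _.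
have en0 : 0 <= e * n%:R by rewrite mulr_ge0// ltW.
rewrite [leRHS](_ : _ = `|c| * (e * n%:R) + `|d| * (e * n%:R) + e * n%:R); last by ring.
lra.
Qed.

Lemma bounded_sublinear f (C : R) : (forall n, `|f n| <= C) -> sublinear f.
Proof.
move=> hC eps eps0; exists (Num.bound (`|C| / eps)) => n hn.
apply: le_trans (hC n) (le_trans (ler_norm _) _).
have h : `|C| / eps < (Num.bound (`|C| / eps))%:R.
  by apply: archi_boundP; rewrite divr_ge0// ltW.
by rewrite -ler_pdivrMl// mulrC (le_trans (ltW h))// ler_nat.
Qed.

Lemma eq_sublinear f g : (forall n, f n = g n) -> sublinear f -> sublinear g.
Proof. by move=> fg hf eps /hf[n0 h]; exists n0 => n /h; rewrite fg. Qed.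

End Sublinear.

(** * From the density of replacements to the frequency of zeros *)

Section Statistics.
Variables (R : realType) (beta : R) (m : nat).
Hypothesis beta_gt1 : 1 < beta.
Hypothesis m_ge2 : (2 <= m)%N.
Hypothesis ones_m : ones_value beta m = 1.
Notation q := (fun j : nat => beta ^- j.+1).
Notation l := (ones_value beta).

Let beta_gt0 : 0 < beta. Proof. by rewrite (lt_trans ltr01). Qed.

(** The expected number of digits of a block. *)
Definition mean_length : R := \sum_(j < m) beta ^- j.+1 * j.+1%:R.

Definition length_excess (s : state) (j : nat) : R := j.+1%:R - mean_length.

Lemma length_excess_mean s : \sum_(j < m) q j * length_excess s j = 0.
Proof.
under eq_bigr do rewrite mulrBr.
by rewrite sumrB -mulr_suml -[X in _ - X * _]/(l m) ones_m mul1r subrr.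
Qed.

(** The letter 0 has probability 1 / beta and multiplies the potential by beta; all other letters
    together have probability 1 - 1 / beta and set it to beta. *)
Lemma drift_mean s : \sum_(j < m) q j * drift beta s j = 0.
Proof.
case: m m_ge2 ones_m => // n _; rewrite /ones_value big_ord_recl /= expr1 => h.
have {}h : \sum_(i < n) beta ^- i.+2 = 1 - beta^-1 by rewrite -h addrC addKr.
rewrite big_ord_recl /= /drift /= expr1.
rewrite -mulr_suml /bump /=; under eq_bigr do rewrite add1n.
by rewrite h; field; rewrite gt_eqF.
Qed.

Lemma potential_bound s : run_ok m s -> 0 <= potential beta s <= beta ^+ m.
Proof.
rewrite /run_ok /potential; case: (run s) => [k km|_]; last by rewrite lexx exprn_ge0// ltW.
by rewrite exprn_ge0 ?(ltW beta_gt0)// ler_eXn2l// ltnW.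
Qed.

Lemma drift_bound s j : run_ok m s -> `|drift beta s j| <= beta * beta ^+ m + 2 * beta.
Proof.
move=> /potential_bound /andP[p0 p1]; rewrite /drift ler_norml.
have b1 := beta_gt1.
have : beta * potential beta s <= beta * beta ^+ m by rewrite ler_wpM2l// ltW.
have : potential beta s <= beta * potential beta s by rewrite ler_peMl// ltW.
case: eqP => _; move=> ? ?; apply/andP; split; lra.
Qed.

Section Traj.
Variables (k0 : nat) (b : nat -> nat) (z : nat -> R).
Hypothesis hb : itinerary m l q b z.

(** Telescoped form of [potential_step]. With a bounded potential and a sublinear path sum it reads
    (beta^m - 1) M + beta^m U = (beta - 1) n + o(n). *)
Lemma traj_potential dec n :
  potential beta (traj m k0 b dec n) + (beta ^+ m - 1) * (nmod (traj m k0 b dec n))%:R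
    + beta ^+ m * (nkeep (traj m k0 b dec n))%:R =
  path_sum (rewrite_step m dec) (drift beta) (start k0) (mkseq b n) + (beta - 1) * n%:R.
Proof.
elim: n => [|n IH]; first by rewrite /traj /potential /= !mulr0 !addr0.
rewrite trajS potential_step IH mkseqS path_sum_rcons -/(traj _ _ _ _ _).
by rewrite -[n.+1]addn1 natrD; ring.
Qed.

Lemma path_sum_length dec n :
  path_sum (rewrite_step m dec) length_excess (start k0) (mkseq b n) =
  (size (word (traj m k0 b dec n)))%:R - k0%:R - mean_length * n%:R.
Proof.
rewrite traj_size//; elim: n => [|n IH]; first by rewrite /= big_ord0 addn0; ring.
rewrite mkseqS path_sum_rcons IH big_ord_recr /= /length_excess !natrD -[n.+1]addn1 natrD.
by ring.
Qed.

(** After n blocks there are n - (m - 1) M zeros among [mean_length] * n + o(n) digits; the last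
    hypothesis says that the limiting ratio is p. *)
Lemma zero_frequency dec (mu p : R) :
    sublinear (fun n => (nmod (traj m k0 b dec n))%:R - mu * n%:R) ->
    sublinear (fun n => path_sum (rewrite_step m dec) length_excess (start k0) (mkseq b n)) ->
    1 - p * mean_length = (m%:R - 1) * mu ->
  has_zero_frequency (digit m k0 b dec) p.
Proof.
move=> hM hL hp; set e := digit m k0 b dec; set t := traj m k0 b dec.
have hD : sublinear (fun n => (count negb (word (t n)))%:R - p * (size (word (t n)))%:R).
  have hk : sublinear (fun=> k0%:R : R).
    by apply: (@bounded_sublinear _ _ k0%:R) => n; rewrite ger0_norm.
  have h := sublinear_affine (- (m%:R - 1)) 1 hM (sublinear_affine (- p) (- p) hL hk).
  apply: (eq_sublinear _ h).
  move=> n; rewrite path_sum_length.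
  have : ((count negb (word (t n)))%:R + (m%:R - 1) * (nmod (t n))%:R : R) = n%:R.
    rewrite -[in RHS](traj_zeros m_ge2 k0 b dec n) natrD natrM; congr (_ + _ * _).
    by rewrite -subn1 natrB// ltnW.
  move: hp; rewrite -/t; set M := (nmod _)%:R; set c := (count _ _)%:R; set s := (size _)%:R.
  move=> hp hc; have -> : c = n%:R - (m%:R - 1) * M by rewrite -hc addrK.
  have -> : (m%:R - 1) * M = (m%:R - 1) * (M - mu * n%:R) + ((m%:R - 1) * mu) * n%:R by ring.
  rewrite -hp; ring.
(* An arbitrary N is compared with a block end within m of it. Digits beyond the final ones number
   at most 2m and the withheld ones at most m, which gives 3m; the term |p| m comes from the
   difference of lengths. *)
have close N : (k0 <= N)%N -> exists2 n, (n <= N)%N &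
    `|(zero_count e N)%:R - p * N%:R| <=
    `|(count negb (word (t n)))%:R - p * (size (word (t n)))%:R| + (3 + `|p|) * m%:R.
  move=> kN; have [n [nN sN Ns]] := traj_time m_ge2 dec (fun n => let: And3 _ bm _ := hb n in bm) kN.
  exists n => //.
  have ok := size_word_le (traj_run_ok m_ge2 k0 b dec n).
  have oN : (size (out (t n)) <= N)%N.
    by apply: leq_trans sN; rewrite /word size_cat leq_addr.
  have [v hv] : exists v, mkseq e N = out (t n) ++ v.
    exists (drop (size (out (t n))) (mkseq e N)).
    rewrite -{1}(cat_take_drop (size (out (t n))) (mkseq e N)); congr (_ ++ _).
    rewrite /mkseq -map_take take_iota (minn_idPl oN) -/(mkseq _ _).
    by rewrite /e (@mkseq_digit m m_ge2 k0 b dec n)// take_size.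
  rewrite zero_countE hv count_cat.
  have sv : (size v = N - size (out (t n)))%N.
    by have := congr1 size hv; rewrite size_mkseq size_cat => ->; rewrite addKn.
  have cv := count_size negb v.
  have cp : (count negb (pending (run (t n))) <= m)%N.
    apply: leq_trans (count_size _ _) _; move: ok; rewrite /word size_cat.
    by rewrite leq_add2l.
  have -> : count negb (word (t n)) =
    (count negb (out (t n)) + count negb (pending (run (t n))))%N by rewrite count_cat.
  have sN' : (size (word (t n)) <= N)%N by [].
  have Ns' : (N <= size (word (t n)) + m)%N by [].
  have cv2 : (count negb v <= 2 * m)%N by move: ok; rewrite -/(t n); lia.
  move: cv2 cp sN' Ns'; clear.
  set s := size _; set c1 := count _ (out _); set c2 := count _ (pending _); set c3 := count _ v.
  rewrite -!(ler_nat R) natrM !natrD => h1 h2 h3 h4.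
  rewrite [X in `|X| <= _](_ : _ = (c1%:R + c2%:R - p * s%:R) + ((c3%:R - c2%:R) - p * (N%:R - s%:R))); last by ring.
  apply: le_trans (ler_normD _ _) _; rewrite lerD2l.
  apply: le_trans (ler_normB _ _) _; rewrite normrM mulrDl; apply: lerD.
    have := ler0n R c3; have := ler0n R c2; rewrite ler_norml => ? ?; apply/andP; split; lra.
  by rewrite ler_wpM2l// ger0_norm ?subr_ge0//; lra.
apply/cvgrPdist_le => eps eps0.
have e2 : 0 < eps / 2 by rewrite divr_gt0.
have [C hC] := sublinear_bound hD e2.
set B := `|C| + (3 + `|p|) * m%:R.
have B0 : 0 <= B by rewrite addr_ge0// mulr_ge0// addr_ge0.
have hb1 : B / (eps / 2) < (Num.bound (B / (eps / 2)))%:R.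
  by apply: archi_boundP; rewrite divr_ge0// ltW.
(* The successor keeps N positive for the division. *)
exists (maxn k0 (Num.bound (B / (eps / 2))).+1) => // N.
rewrite /mkset geq_max => /andP[kN bN].
have N0 : 0 < N%:R :> R by rewrite ltr0n (leq_trans _ bN).
have [n nN hn] := close N kN.
rewrite distrC (_ : _ - p = ((zero_count e N)%:R - p * N%:R) / N%:R); last first.
  by field; rewrite gt_eqF.
rewrite normrM [`|_^-1|]gtr0_norm ?invr_gt0// ler_pdivrMr//.
apply: le_trans hn _.
have := hC n; rewrite -/(t n) => hCn.
have nNR : (eps / 2) * n%:R <= (eps / 2) * N%:R by rewrite ler_wpM2l ?ler_nat// ltW.
have BN : B <= (eps / 2) * N%:R.
  rewrite mulrC -ler_pdivrMr//; apply: le_trans (ltW hb1) _.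
  by rewrite ler_nat ltnW.
have := ler_norm C; rewrite /B in BN; lra.
Qed.

End Traj.
End Statistics.

(** * Decision rules realizing a prescribed density of replacements *)

Section Selection.
Variables (R : realType) (beta : R) (m : nat).
Hypothesis beta_gt1 : 1 < beta.
Hypothesis m_ge2 : (2 <= m)%N.
Hypothesis ones_m : ones_value beta m = 1.
Notation q := (fun j : nat => beta ^- j.+1).
Notation l := (ones_value beta).

Let beta_gt0 : 0 < beta. Proof. by rewrite (lt_trans ltr01). Qed.

(** The reference rule, with which [balance c d N] agrees before step N. *)
Definition never (i M U : nat) : bool := false.

(* After step N the rule keeps c * nmod - d * nkeep bounded; forcing a first
   rewriting at step N makes the resulting expansions pairwise different. *)
Definition balance (c d : R) (N i M U : nat) : bool :=
  (i == N) || ((N < i)%N && (c * M%:R <= d * U%:R)).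

Lemma counts_step dec s j :
  [\/ nmod (rewrite_step m dec s j) = nmod s /\ nkeep (rewrite_step m dec s j) = nkeep s,
      [/\ nmod (rewrite_step m dec s j) = (nmod s).+1,
        nkeep (rewrite_step m dec s j) = nkeep s & dec (clock s) (nmod s) (nkeep s)] |
      [/\ nmod (rewrite_step m dec s j) = nmod s,
        nkeep (rewrite_step m dec s j) = (nkeep s).+1,
        ~~ dec (clock s) (nmod s) (nkeep s),
        j = 0%N & run s = Some m.-1]].
Proof.
case: s j => o [k|] M U i [|j] /=; try by apply: Or31.
case: eqP => [<-|_] /=; last by apply: Or31.
by case: (boolP (dec i M U)) => h /=; [apply: Or32|apply: Or33].
Qed.

(** Up to step N each block moves the difference by at most c + d. Later it rises by c only when it
    is at most 0 and falls by d only when it is positive, so the bound stops growing. *)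
Lemma balance_bound (c d : R) k0 b N n : 0 <= c -> 0 <= d ->
  let s := traj m k0 b (balance c d N) n in
  `|c * (nmod s)%:R - d * (nkeep s)%:R| <= (c + d) * (minn n N.+1)%:R.
Proof.
move=> c0 d0; elim: n => [|n /= IH]; first by rewrite /= !mulr0 subrr normr0.
rewrite trajS; set s := traj _ _ _ _ n in IH *.
have cl : clock s = n by exact: traj_clock.
have [nN|Nn] := ltnP n N.+1.
  have E : (minn n.+1 N.+1)%:R = (minn n N.+1)%:R + 1 :> R.
    by rewrite (minn_idPl nN) (minn_idPl (ltnW nN)) -natr1.
  rewrite E mulrDr mulr1; move: IH; rewrite !ler_norml => /andP[h1 h2].
  case: (counts_step (balance c d N) s (b n)) => [[-> ->]|[-> -> _]|[-> -> _ _ _]];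
    rewrite -?natr1; apply/andP; split; lra.
have E : minn n.+1 N.+1 = minn n N.+1 by rewrite !(minn_idPr _)// ltnW.
rewrite E.
have E1 : c + d <= (c + d) * (minn n N.+1)%:R.
  by rewrite ler_peMr ?addr_ge0// (minn_idPr Nn) ler1n.
move: IH; rewrite !ler_norml => /andP[h1 h2].
case: (counts_step (balance c d N) s (b n)) => [[-> ->]|[-> -> ]|[-> -> + _ _]];
  rewrite ?h1 ?h2// /balance cl gtn_eqF//= Nn /=.
  by move=> h; rewrite -natr1; apply/andP; split; lra.
by rewrite -ltNge => h; rewrite -natr1; apply/andP; split; lra.
Qed.

(* Together with (beta^m - 1) M + beta^m U = (beta - 1) n + o(n), the boundedness
   of c M - d U determines M / n; these c and d make its limit mu. *)
Lemma balance_density (mu : R) k0 b N :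
    0 <= mu <= 2 - beta ->
    let dec := balance ((beta - 1) - mu * (beta ^+ m - 1)) (mu * beta ^+ m) N in
    sublinear (fun n => path_sum (rewrite_step m dec) (drift beta) (start k0) (mkseq b n)) ->
  sublinear (fun n => (nmod (traj m k0 b dec n))%:R - mu * n%:R).
Proof.
move=> /andP[mu0 mu1]; set B := beta ^+ m; set c := _ - _; set d := mu * B.
move=> dec hS.
have B0 : 0 < B by rewrite exprn_gt0.
have BE : B * (2 - beta) = 1 by rewrite -(beta_expm beta_gt1 ones_m) divff// gt_eqF.
have B1 : 1 < B by rewrite exprn_egt1// -lt0n ltnW.
(* As B (2 - beta) = 1, the hypothesis mu <= 2 - beta amounts to c >= 0; equality is the case where
   every word after step N is replaced. *)
have c0 : 0 <= c.
  have : mu * (B - 1) <= (2 - beta) * (B - 1) by rewrite ler_wpM2r// subr_ge0 ltW.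
  by rewrite /c; lra.
have d0 : 0 <= d by rewrite mulr_ge0// ltW.
have Bb : 0 < B * (beta - 1) by rewrite mulr_gt0// subr_gt0.
pose s n := traj m k0 b dec n.
have hbal : sublinear (fun n => c * (nmod (s n))%:R - d * (nkeep (s n))%:R).
  apply: (@bounded_sublinear _ _ ((c + d) * N.+1%:R)) => n.
  apply: le_trans (balance_bound k0 b N n c0 d0) _.
  by apply: ler_wpM2l; [exact: addr_ge0|rewrite ler_nat geq_minr].
have hpot : sublinear (fun n => potential beta (s n)).
  apply: (@bounded_sublinear _ _ B) => n.
  have /andP[p0 p1] := potential_bound beta_gt1 (traj_run_ok m_ge2 k0 b dec n).
  by rewrite ger0_norm.
(* Cramer's rule for the two relations between M and U, with determinant d (B - 1) + c B = B (beta -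
   1). *)
have h := sublinear_affine (d / (B * (beta - 1))) (beta - 1)^-1
  (sublinear_affine 1 (-1) hS hpot) hbal.
apply: (eq_sublinear _ h) => n.
have -> : path_sum (rewrite_step m dec) (drift beta) (start k0) (mkseq b n) =
    potential beta (s n) + (B - 1) * (nmod (s n))%:R + B * (nkeep (s n))%:R - (beta - 1) * n%:R.
  by rewrite traj_potential addrK.
rewrite /c /d -/(s n); field.
by rewrite subr_eq0 !gt_eqF.
Qed.

(** The steps at which block 0 completes a word 1 0^m when nothing has been replaced: the possible
    places of a first replacement. *)
Definition site k0 b N := b N = 0%N /\ run (traj m k0 b never N) = Some m.-1.

(** Otherwise M = 0 and U is bounded, so the potential identity would make (beta - 1) n
    sublinear. *)
Lemma sites_infinite k0 b :
    sublinear (fun n => path_sum (rewrite_step m never) (drift beta) (start k0) (mkseq b n)) ->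
  infinite_set [set N | site k0 b N].
Proof.
move=> hS.
have unbounded N0 : exists2 N, (N0 <= N)%N & site k0 b N.
  apply: contrapT => /forall2NP none.
  pose s n := traj m k0 b never n.
  have counts n : nmod (s n) = 0%N /\ (nkeep (s n) <= minn n N0)%N.
    elim: n => [|n [M0 U0]] //; rewrite /s trajS -/(s n).
    case: (counts_step never (s n) (b n)) => [[-> ->]|[]//|[-> -> _ bn rn]].
      by split=> //; apply: leq_trans U0 _; rewrite leq_min geq_minr andbT; lia.
    split=> //; have [/negP|/(_ (conj bn rn))//] := none n.
    by rewrite -ltnNge => nN0; move: U0; rewrite !(minn_idPl _)// ltnW.
  have hpot : sublinear (fun n => potential beta (s n) + beta ^+ m * (nkeep (s n))%:R).
    apply: (@bounded_sublinear _ _ (beta ^+ m + beta ^+ m * N0%:R)) => n.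
    have /andP[p0 p1] := potential_bound beta_gt1 (traj_run_ok m_ge2 k0 b never n).
    have Bm : 0 <= beta ^+ m by rewrite exprn_ge0// ltW.
    rewrite ger0_norm ?addr_ge0 ?mulr_ge0// lerD// ler_wpM2l// ler_nat.
    by apply: leq_trans (counts n).2 _; exact: geq_minr.
  have e0 : 0 < (beta - 1) / 2 by rewrite divr_gt0// subr_gt0.
  have [n1 /(_ n1.+1 (leqnSn _))] := sublinear_affine 1 (-1) hpot hS e0.
  have -> : 1 * (potential beta (s n1.+1) + beta ^+ m * (nkeep (s n1.+1))%:R) +
      -1 * path_sum (rewrite_step m never) (drift beta) (start k0) (mkseq b n1.+1) =
      (beta - 1) * n1.+1%:R.
    have := @traj_potential R beta m k0 b never n1.+1.
    by rewrite -/(s _) (counts n1.+1).1 mulr0 addr0; lra.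
  rewrite ger0_norm ?mulr_ge0 ?subr_ge0 ?(ltW beta_gt1)// ler_pM2r ?ltr0n//; lra.
move=> /finite_seqP[w wE].
have [N] := unbounded (\max_(i <- w) i).+1.
move=> + siteN; have : [set` w] N by rewrite -wE.
by move=> /= Nw; rewrite ltnNge (@leq_bigmax_seq _ w xpredT id).
Qed.

Lemma traj_balance c d k0 b N n : (n <= N)%N ->
  traj m k0 b (balance c d N) n = traj m k0 b never n.
Proof.
elim: n => [|n IH] nN //; rewrite !trajS IH ?(ltnW nN)//.
have := traj_clock m k0 b never n; case: (traj m k0 b never n) => o r M U i /= ->.
by rewrite /balance (ltn_eqF nN) ltnNge (ltnW nN) /=; case: (b n).
Qed.

Lemma site_step dec s : run s = Some m.-1 ->
  out (rewrite_step m dec s 0) = out s ++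
    (if dec (clock s) (nmod s) (nkeep s) then false :: nseq m.-1 true
     else true :: nseq m false).
Proof.
by case: s => o r M U i /= ->; rewrite prednK ?eqxx; [case: dec|exact: ltnW].
Qed.

(** Both rules reach step N with the same output; there one writes 0 1^(m-1) and the other 1 0^m, at
    the same position. *)
Lemma digit_balance_neq c d k0 b N N' : site k0 b N -> (N < N')%N ->
  digit m k0 b (balance c d N) <> digit m k0 b (balance c d N').
Proof.
move=> [bN rN] NN'; set s := traj m k0 b never N in rN *.
have cl : clock s = N by exact: traj_clock.
have outE N1 : (N <= N1)%N -> out (traj m k0 b (balance c d N1) N.+1) =
    out s ++ (if N == N1 then false :: nseq m.-1 true else true :: nseq m false).
  move=> le_N; rewrite trajS traj_balance// bN site_step// -/s cl /balance.
  by rewrite ltnNge le_N orbF.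
move=> /(congr1 (fun e => e (size (out s)))).
rewrite !(@digitE m m_ge2 k0 b _ N.+1) !outE ?(ltnW NN')// ?size_cat ?eqxx ?(ltn_eqF NN')/=;
  try by rewrite -addn1 leq_add2l.
by rewrite !nth_cat ltnn subnn.
Qed.

(** The sites index infinitely many distinct expansions. The drift depends on the rule and is
    assumed sublinear for each N, whereas block lengths are the same under all rules. *)
Lemma expansions_infinite k0 b z (p : R) :
    itinerary m l q b z ->
    let mu := (1 - p * mean_length beta m) / (m%:R - 1) in
    let c := (beta - 1) - mu * (beta ^+ m - 1) in
    let d := mu * beta ^+ m in
    0 <= mu <= 2 - beta ->
    sublinear (fun n => path_sum (rewrite_step m never) (length_excess beta m) (start k0) (mkseq b n)) ->
    sublinear (fun n => path_sum (rewrite_step m never) (drift beta) (start k0) (mkseq b n)) ->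
    (forall N, sublinear (fun n =>
      path_sum (rewrite_step m (balance c d N)) (drift beta) (start k0) (mkseq b n))) ->
  infinite_set [set e : nat -> bool |
    is_beta_expansion beta (l k0 + beta ^- k0 * z 0%N) e /\ has_zero_frequency e p].
Proof.
move=> hb mu c d hmu hL hnever hbal.
pose e N := digit m k0 b (balance c d N).
have inf : infinite_set (e @` [set N | site k0 b N]).
  have e_inj : {in [set N | site k0 b N] &, injective e}.
    move=> N N' /set_mem sN /set_mem sN' eN.
    have [h|h|//] := ltngtP N N'.
      by have := @digit_balance_neq c d _ _ _ _ sN h.
    by have := @digit_balance_neq c d _ _ _ _ sN' h; rewrite -/(e N) -/(e N') eN.
  by rewrite (eq_finite_set (inj_card_eq e_inj)); exact: sites_infinite hnever.
apply: sub_infinite_set inf => _ [N _ <-]; split.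
  exact: digit_expansion.
apply: (zero_frequency beta_gt1 m_ge2 hb (mu := mu)).
- exact: balance_density.
- apply: (eq_sublinear _ hL) => n.
  by rewrite !path_sum_length// !traj_size.
- by rewrite /mu [RHS]mulrC divfK// gt_eqF// subr_gt0 ltr1n.
Qed.
End Selection.

(** * Frequencies at least 1/2, almost everywhere *)

Section AlmostEverywhere.
Variables (R : realType) (beta : R) (m : nat).
Hypothesis beta_gt1 : 1 < beta.
Hypothesis m_ge2 : (2 <= m)%N.
Hypothesis ones_m : ones_value beta m = 1.
Notation q := (fun j : nat => beta ^- j.+1).
Notation l := (ones_value beta).

Let beta_gt0 : 0 < beta. Proof. by rewrite (lt_trans ltr01). Qed.

(** Relates the denominator in c to the mean block length; it yields 1/2 + c = 1 / [mean_length],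
    the frequency with one zero per block. *)
Lemma mean_lengthE :
  mean_length beta m * (beta - 1) = m%:R * beta + beta - 2 * m%:R.
Proof.
have partial n : (\sum_(j < n) beta ^- j.+1 * j.+1%:R) * (beta - 1) =
    beta * l n - n%:R * beta ^- n.
  elim: n => [|n IH]; first by rewrite /l !big_ord0; ring.
  rewrite big_ord_recr mulrDl IH ones_valueS -natr1 /=.
  have -> : beta ^- n = beta * beta ^- n.+1.
    by rewrite exprS invfM mulrA divff ?mul1r// gt_eqF.
  by ring.
by rewrite /mean_length partial ones_m (beta_expm beta_gt1 ones_m); ring.
Qed.

(** From beta^-m <= beta^-2 one gets (beta - 1)(beta^2 - beta - 1) >= 0, so beta is at least the
    golden ratio. *)
Lemma three_halves_le : 3 / 2 <= beta.
Proof.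
have B1 : beta ^- m <= beta ^- 2 by rewrite lef_pV2 ?posrE ?exprn_gt0// ler_eXn2l.
have : (2 - beta) * beta ^+ 2 <= 1.
  by rewrite -(beta_expm beta_gt1 ones_m) -ler_pdivlMr ?exprn_gt0// mul1r.
move=> h1; have b1 := beta_gt1.
have h : 0 <= (beta - 1) * (beta * (beta - 1) - 1).
  have -> : (beta - 1) * (beta * (beta - 1) - 1) = 1 - (2 - beta) * beta ^+ 2 by ring.
  by rewrite subr_ge0.
rewrite pmulr_rge0 ?subr_gt0// in h.
rewrite leNgt; apply/negP => b2; nra.
Qed.

(** The values l k increase to 1 / (beta - 1), and consecutive ones differ by beta^-(k+1) <=
    beta^-k. *)
Lemma ones_prefix (x : R) : 0 <= x < (beta - 1)^-1 ->
  exists k y, 0 <= y < 1 /\ x = l k + beta ^- k * y.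
Proof.
move=> /andP[x0 x1].
have b1 : 0 < beta - 1 by rewrite subr_gt0.
have [n xn] : exists n, x < l n.
  have e0 : 0 < 1 - x * (beta - 1) by rewrite subr_gt0 -ltr_pdivlMr// mul1r.
  have bV : `|beta^-1| < 1 by rewrite gtr0_norm ?invr_gt0// invf_lt1.
  have /cvgrPdist_lt /(_ _ e0) [n _ /(_ n (leqnn n))] := @cvg_geometric R 1 _ bV.
  rewrite /= mul1r sub0r normrN => hn; exists n.
  rewrite ones_valueE// ltr_pdivlMr//.
  have := le_lt_trans (ler_norm _) hn; rewrite exprVn; lra.
have [k [lk kx]] : exists k, l k <= x /\ x < l k.+1.
  elim: n xn => [|n IH] xn; first by move: xn; rewrite /l big_ord0 ltNge x0.
  by have [/IH|h] := ltP x (l n); [|exists n].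
have k0 : 0 < beta ^+ k by rewrite exprn_gt0.
exists k, (beta ^+ k * (x - l k)); split; last by rewrite mulKf ?gt_eqF// addrC subrK.
rewrite mulr_ge0 ?(ltW k0) ?subr_ge0//= -ltr_pdivlMl// mulr1 ltrBlDr addrC.
apply: lt_le_trans kx _; rewrite ones_valueS lerD2l.
by rewrite lef_pV2 ?posrE ?exprn_gt0// ler_eXn2l.
Qed.

(** The affine image s + r x lets the same statement serve the identity and the reflection of the
    interval. *)
Lemma expansions_infinite_ae (p s r : R) :
    1 / 2 <= p -> p * mean_length beta m <= 1 ->
  (@lebesgue_measure R).-negligible [set y | exists x : R,
    [/\ 0 <= x < (beta - 1)^-1, y = s + r * x &
     ~ infinite_set [set e : nat -> bool |
         is_beta_expansion beta x e /\ has_zero_frequency e p]]].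
Proof.
move=> p_ge p_le.
set mu := (1 - p * mean_length beta m) / (m%:R - 1).
set c := (beta - 1) - mu * (beta ^+ m - 1).
set d := mu * beta ^+ m.
have m1 : 1 <= m%:R - 1 :> R.
  by rewrite lerBrDr -[1 + 1]/(2%:R) ler_nat.
have hmu : 0 <= mu <= 2 - beta.
  rewrite divr_ge0 ?subr_ge0 ?(le_trans ler01 m1)//=; last by rewrite -subr_ge0 (le_trans ler01).
  rewrite ler_pdivrMr ?(lt_le_trans ltr01)//.
  have b1 : 0 < beta - 1 by rewrite subr_gt0.
  have ell0 : 0 <= mean_length beta m * (beta - 1).
    apply: mulr_ge0; last exact: ltW.
    by apply: sumr_ge0 => j _; rewrite mulr_ge0// invr_ge0 exprn_ge0// ltW.
  rewrite -(ler_pM2r b1) mulrBl mul1r -mulrA; move: ell0; rewrite mean_lengthE => ell0.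
  have h : 0 <= (2 - beta) * (m%:R - 1).
    by rewrite -(beta_expm beta_gt1 ones_m) mulr_ge0 ?invr_ge0 ?exprn_ge0 ?(ltW beta_gt0)// (le_trans ler01).
  (* Multiplied by (m - 1)(beta - 1), the inequality mu <= 2 - beta has slack exactly [h2] +
     [h3]. *)
  have h2 : 0 <= (2 - beta) * (m%:R - 1) * (beta - 3 / 2).
    by rewrite mulr_ge0// subr_ge0 three_halves_le.
  have h3 : 0 <= (p - 1 / 2) * (m%:R * beta + beta - 2 * m%:R) by rewrite mulr_ge0// subr_ge0.
  lra.
pose bad (k : nat) dec (X : state -> nat -> R) := [set y : R | exists b z,
    [/\ itinerary m l q b z, y = (s + r * l k) + (r * beta ^- k) * z 0%N &
     ~ sublinear (fun n => path_sum (rewrite_step m dec) X (start k) (mkseq b n))]].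
have q0 j : 0 < q j by rewrite invr_gt0 exprn_gt0.
have bad_drift k dec : (@lebesgue_measure R).-negligible (bad k dec (drift beta)).
  apply: (@martingale_strong_law R m l q state (rewrite_step m dec) (drift beta)
    (run_ok m) (beta * beta ^+ m + 2 * beta)) => //.
  - by move=> s' j Is _; exact: run_ok_step.
  - by move=> s' _; exact: drift_mean.
  - by move=> s' j Is _; exact: drift_bound.
have bad_length k : (@lebesgue_measure R).-negligible (bad k never (length_excess beta m)).
  apply: (@martingale_strong_law R m l q state (rewrite_step m never) (length_excess beta m)
    (fun=> True) (m%:R + `|mean_length beta m|)) => //.
  - by move=> s' _; exact: length_excess_mean.
  - move=> s' j _ jm; apply: le_trans (ler_normB _ _) _.
    by rewrite lerD2r ger0_norm// ler_nat.
(* Only countably many prefixes 1^k and rules N occur, so the exceptional sets have a negligible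
   union. *)
have neg : (@lebesgue_measure R).-negligible (\bigcup_k
    ((bad k never (length_excess beta m) `|` bad k never (drift beta)) `|`
     \bigcup_N bad k (balance c d N) (drift beta))).
  apply: negligible_bigcup => k; apply: negligibleU; first exact: negligibleU.
  exact: negligible_bigcup.
apply: negligibleS neg => y [x [hx yE x_bad]].
have [k [u [u01 xE]]] := ones_prefix hx.
have [b [z [hb zu]]] := itinerary_exists beta_gt1 ones_m u01.
have yE' : y = (s + r * l k) + (r * beta ^- k) * z 0%N by rewrite yE xE zu; ring.
exists k => //; apply: contrapT => /not_orP[/not_orP[h1 h2] h3].
apply: x_bad; rewrite xE -zu.
apply: (expansions_infinite beta_gt1 m_ge2 ones_m hb hmu).
- by apply: contrapT => h; apply: h1; exists b, z.
- by apply: contrapT => h; apply: h2; exists b, z.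
- by move=> N; apply: contrapT => h; apply: h3; exists N => //; exists b, z.
Qed.

End AlmostEverywhere.

(** * Reflection of expansions and conclusion *)

Lemma expansion_complement (R : realType) (beta x : R) (e : nat -> bool) :
    1 < beta -> is_beta_expansion beta x e ->
  is_beta_expansion beta ((beta - 1)^-1 - x) (fun i => ~~ e i).
Proof.
move=> beta_gt1 he; rewrite /is_beta_expansion.
have all_ones : series (fun i => beta ^- i.+1) @ \oo --> (beta - 1)^-1.
  have -> : (beta - 1)^-1 = beta^-1 / (1 - beta^-1).
    by field; rewrite subr_eq0 !gt_eqF// (lt_trans ltr01).
  have -> : series (fun i => beta ^- i.+1) = series (geometric beta^-1 beta^-1).
    apply/funext => n; apply: eq_bigr => i _ /=.
    by rewrite exprVn exprS invfM.
  by apply: cvg_geometric_series; rewrite gtr0_norm ?invr_gt0 ?(lt_trans ltr01)// invf_lt1// (lt_trans ltr01).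
have -> : series (fun i => (~~ e i)%:R * beta ^- i.+1) =
    series (fun i => beta ^- i.+1) - series (fun i => (e i)%:R * beta ^- i.+1).
  apply/funext => n; rewrite /series /= -[RHS]sumrB; apply: eq_bigr => i _.
  by case: (e i); rewrite ?mul1r ?mul0r ?subrr ?subr0.
exact: cvgB.
Qed.

Lemma zero_frequency_complement (R : realType) (p : R) (e : nat -> bool) :
  has_zero_frequency e p -> has_zero_frequency (fun i => ~~ e i) (1 - p).
Proof.
move=> he; rewrite /has_zero_frequency.
have h : (fun n => 1 - (zero_count e n)%:R / n%:R : R) @ \oo --> 1 - p.
  by apply: cvgB => //; exact: cvg_cst.
(* The two sequences differ at n = 0, where the quotients are 0. *)
apply: cvg_trans h; apply: near_eq_cvg; exists 1%N => // n /= n0.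
have nz : n%:R != 0 :> R by rewrite pnatr_eq0 -lt0n.
have -> : (zero_count (fun i => ~~ e i) n)%:R = n%:R - (zero_count e n)%:R :> R.
  apply/eqP; rewrite eq_sym subr_eq -natrD; apply/eqP; congr (_%:R).
  rewrite !zero_countE -[LHS](size_mkseq e) -(count_predC negb) addnC; congr addn.
  by rewrite /mkseq !count_map.
by rewrite mulrBl divff.
Qed.

Theorem theorem1p3 (R : realType) (beta : R) (m : nat)
    (hbeta : 1 < beta < 2) (hm : (2 <= m)%N)
    (hroot : beta ^+ m - \sum_(k < m) beta ^+ k = 0) :
  let c : R := ((m%:R - 1) * (2 - beta)) /
               (2 * (m%:R * beta + beta - 2 * m%:R)) in
  0 < c /\
  forall p : R, 1 / 2 - c <= p <= 1 / 2 + c ->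
    {ae @lebesgue_measure R, forall x : R, beta_interval beta x ->
      infinite_set [set e : nat -> bool |
        is_beta_expansion beta x e /\ has_zero_frequency e p]}.
Proof.
move=> c; have /andP[beta_gt1 beta_lt2] := hbeta.
have beta_gt0 : 0 < beta by rewrite (lt_trans ltr01).
have b1 : 0 < beta - 1 by rewrite subr_gt0.
have ones_m : ones_value beta m = 1.
  (* The root equation times beta - 1 telescopes to beta^m - 1 = (beta - 1) beta^m. *)
  have Bm : beta ^+ m * (2 - beta) = 1.
    have /eqP := hroot; rewrite subr_eq0 => /eqP h.
    have := subrX1 beta m; rewrite -h => h2.
    have -> : beta ^+ m * (2 - beta) = beta ^+ m - (beta - 1) * beta ^+ m by ring.
    by rewrite -h2; ring.
  have B0 : beta ^+ m != 0 by rewrite gt_eqF// exprn_gt0.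
  rewrite ones_valueE//.
  have -> : beta ^- m = 2 - beta by apply: (mulfI B0); rewrite divff// Bm.
  have -> : 1 - (2 - beta) = beta - 1 by ring.
  by rewrite divff// gt_eqF.
have ellE := mean_lengthE beta_gt1 ones_m.
have E0 : 0 < m%:R * beta + beta - 2 * m%:R.
  rewrite -ellE mulr_gt0//.
  have m0 : (0 < m)%N by exact: ltnW.
  rewrite /mean_length (bigD1 (Ordinal m0))//= ltr_pwDl//.
    by rewrite mulr1 invr_gt0 expr1.
  by apply: sumr_ge0 => j _; rewrite mulr_ge0// invr_ge0 exprn_ge0// ltW.
have m1 : 0 < m%:R - 1 :> R by rewrite subr_gt0 ltr1n.
have c0 : 0 < c by rewrite divr_gt0 ?mulr_gt0// subr_gt0.
split=> // p /andP[p_ge p_le].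
have ub u : u <= 1 / 2 + c -> u * mean_length beta m <= 1.
  move=> uc; rewrite -(ler_pM2r b1) -mulrA ellE mul1r.
  have -> : beta - 1 = (1 / 2 + c) * (m%:R * beta + beta - 2 * m%:R).
    by rewrite /c; field; rewrite gt_eqF.
  by rewrite ler_pM2r.
(* Removes the one endpoint that has no finite prefix of ones followed by a point of [0, 1). *)
have point (a : R) : (@lebesgue_measure R).-negligible [set a].
  by apply/negligibleP => //; exact: lebesgue_measure_set1.
rewrite /almost_everywhere.
have [p2|p2] := leP (1 / 2) p.
  have neg := expansions_infinite_ae beta_gt1 hm ones_m 0 1 p2 (ub _ p_le).
  apply: negligibleS (negligibleU neg (point (beta - 1)^-1)) => x /=.
  rewrite /beta_interval /= in_itv /= => /not_implyP[/andP[x0]].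
  rewrite le_eqVlt => /orP[/eqP-> _|x1 hx]; [by right|left].
  by exists x; rewrite x0 x1 add0r mul1r.
have p2' : 1 / 2 <= 1 - p by lra.
have p_le' : 1 - p <= 1 / 2 + c by lra.
(* The case 1 - p > 1/2 is applied at the reflected point; exchanging digits carries its expansions
   back. *)
have neg := expansions_infinite_ae beta_gt1 hm ones_m (beta - 1)^-1 (-1) p2' (ub _ p_le').
apply: negligibleS (negligibleU neg (point 0)) => x /=.
rewrite /beta_interval /= in_itv /= => /not_implyP[/andP[x0 x1]].
move: x0; rewrite le_eqVlt => /orP[/eqP<- _|x0 hx]; [by right|left].
exists ((beta - 1)^-1 - x); split.
- by rewrite subr_ge0 x1 gtrBl.
- by ring.
move=> hinf; apply: hx.
pose flip (e : nat -> bool) := fun i => ~~ e i.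
have flipK : involutive flip by move=> e; apply/funext => i; rewrite /flip negbK.
have inj : {in [set e : nat -> bool | is_beta_expansion beta ((beta - 1)^-1 - x) e /\
    has_zero_frequency e (1 - p)] &, injective flip}.
  by move=> e e' _ _; exact: (inv_inj flipK).
rewrite -(eq_finite_set (inj_card_eq inj)) in hinf.
apply: sub_infinite_set hinf => _ [e [he hf] <-]; split.
  by have := expansion_complement beta_gt1 he; rewrite subKr.
by have := zero_frequency_complement hf; rewrite subKr.
Qed.
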